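(* Let $W\in\mathbb{R}^{m\times n}$ be a matrix with $\|W\|_F\le C_W$. (i) For every $P\in\mathbb{R}^{m\times r}$ with orthonormal columns, $\|P^{\top}W\|_F\le C_W$. (ii) For every $P\in\mathbb{R}^{r\times n}$ with orthonormal rows, $\|WP^{\top}\|_F\le C_W$.
   Context: $\|\cdot\|_F$ denotes the Frobenius norm and $^{\top}$ denotes transpose. $P\in\mathbb{R}^{m\times r}$ has orthonormal columns if $P^{\top}P=I_r$; $P\in\mathbb{R}^{r\times n}$ has orthonormal rows if $PP^{\top}=I_r$. *)

(* Defs.v *)
From mathcomp Require Import all_boot all_order all_algebra.
From mathcomp Require Import reals.

Set Implicit Arguments.
Unset Strict Implicit.
Unset Printing Implicit Defensive.

Local Open Scope ring_scope.

Definition frobenius_norm (R : realType) (m n : nat) (A : 'M[R]_(m, n)) : R :=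
  Num.sqrt (\sum_(i < m) \sum_(j < n) A i j ^+ 2).

Definition orthonormal_cols (R : realType) (m r : nat) (P : 'M[R]_(m, r)) :
  Prop := P^T *m P = 1%:M.

Definition orthonormal_rows (R : realType) (r n : nat) (P : 'M[R]_(r, n)) :
  Prop := P *m P^T = 1%:M.

(* Main.v *)
(** With [Q = W - P *m P^T *m W], orthonormality of the columns of [P] gives the
    Pythagorean identity |W|^2 = |P^T W|^2 + |Q|^2, read off from
    |A|^2 = tr (A^T A). Part (ii) is part (i) transposed. *)
Require Import Defs.
From mathcomp Require Import all_boot all_order all_algebra.
From mathcomp Require Import reals.

Import Order.TTheory GRing.Theory Num.Theory.

Local Open Scope ring_scope.

Lemma mxtrace_trmx_mul (R : comNzRingType) (m n : nat) (A : 'M[R]_(m, n)) :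
  \tr (A^T *m A) = \sum_(i < m) \sum_(j < n) A i j ^+ 2.
Proof.
rewrite exchange_big; apply: eq_bigr => j _; rewrite mxE.
by apply: eq_bigr => i _; rewrite mxE expr2.
Qed.

Lemma mxtrace_trmx_mul_ge0 (R : realDomainType) (m n : nat) (A : 'M[R]_(m, n)) :
  0 <= \tr (A^T *m A).
Proof.
rewrite mxtrace_trmx_mul; apply: sumr_ge0 => i _.
by apply: sumr_ge0 => j _; apply: sqr_ge0.
Qed.

Lemma frobenius_normE (R : realType) (m n : nat) (A : 'M[R]_(m, n)) :
  frobenius_norm A = Num.sqrt (\tr (A^T *m A)).
Proof. by rewrite mxtrace_trmx_mul. Qed.

(** Cyclicity of the trace exchanges the two Gram matrices [A^T *m A] and [A *m A^T]. *)
Lemma frobenius_norm_trmx (R : realType) (m n : nat) (A : 'M[R]_(m, n)) :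
  frobenius_norm A^T = frobenius_norm A.
Proof. by rewrite !frobenius_normE trmxK mxtrace_mulC. Qed.

(** [P *m P^T] is the orthogonal projector onto the column span of [P], so the residual [Q]
    satisfies [P^T *m Q = 0] and the cross terms collapse. *)
Lemma gram_sub_proj (R : comNzRingType) (m n r : nat) (P : 'M[R]_(m, r))
    (W : 'M[R]_(m, n)) :
  P^T *m P = 1%:M ->
  (W - P *m (P^T *m W))^T *m (W - P *m (P^T *m W)) =
  W^T *m W - (P^T *m W)^T *m (P^T *m W).
Proof.
move=> PP1; have PQ0 : P^T *m (W - P *m (P^T *m W)) = 0.
  by rewrite mulmxBr (mulmxA _ P) PP1 mul1mx subrr.
(* Only the left factor is expanded: its projected part ends in [P^T] and annihilates [Q], leaving
   [W^T *m Q]. *)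
rewrite [(_ - _)^T]linearB /= (trmx_mul P) mulmxBl -(mulmxA _ P^T) PQ0 mulmx0 subr0.
by rewrite mulmxBr trmx_mul trmxK !mulmxA.
Qed.

Lemma frobenius_norm_mul_orthonormal_cols (R : realType) (m n r : nat)
    (P : 'M[R]_(m, r)) (W : 'M[R]_(m, n)) :
  orthonormal_cols P -> frobenius_norm (P^T *m W) <= frobenius_norm W.
Proof.
move=> PP1; rewrite !frobenius_normE ler_wsqrtr // -subr_ge0 -raddfB /=.
(* The difference of the squared norms is the trace of the Gram matrix of [Q], hence nonnegative. *)
by rewrite -gram_sub_proj //; apply: mxtrace_trmx_mul_ge0.
Qed.

Theorem lemma5p1 (R : realType) (m n : nat) (W : 'M[R]_(m, n)) (C_W : R)
    (hW : frobenius_norm W <= C_W) :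
  (forall (r : nat) (P : 'M[R]_(m, r)),
      orthonormal_cols P -> frobenius_norm (P^T *m W) <= C_W)
  /\
  (forall (r : nat) (P : 'M[R]_(r, n)),
      orthonormal_rows P -> frobenius_norm (W *m P^T) <= C_W).
Proof.
split=> r P oP; apply: le_trans hW.
  exact: frobenius_norm_mul_orthonormal_cols.
(* Transposing turns the product into [P^T^T *m W^T], where [P^T] has orthonormal columns. *)
rewrite -frobenius_norm_trmx trmx_mul -(frobenius_norm_trmx _ _ _ W).
by apply: frobenius_norm_mul_orthonormal_cols; rewrite /orthonormal_cols trmxK.
Qed.
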